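(* Let $\mathbb{F}$ be a field, let $G$ be a finite group, let $n\ge 1$, and let $\rho : G \to \mathrm{GL}(\mathbb{F}^n)$ be an irreducible representation. Let $R\ge 1$ be an integer and let $h \in G$ be such that $$0 < \operatorname{rank}\left(\rho(h) - \mathbf{I}\right) \leq R.$$ Then there exists a special linear $(2,\delta)$-LDC $A = (a_1,\ldots,a_m) \in (\mathbb{F}^t)^m$ with $$m = |G|, \quad t = \lceil n/R \rceil, \quad \text{and} \quad \delta = \frac{\theta_{\mathbb{F}}\gamma_h}{2}.$$
   Context: $\mathbf{I}$ is the $n\times n$ identity matrix. The constant $\theta_{\mathbb{F}}$ is defined by $\theta_{\mathbb{F}} = 1$ if $\mathbb{F}$ is infinite, and $\theta_{\mathbb{F}} = 1 - \frac{1}{|\mathbb{F}|}$ if $\mathbb{F}$ is finite. For $h\in G$ with order $\mathrm{ord}(h)$ in $G$, the constant $\gamma_h$ is defined by $\gamma_h = 1$ if $\mathrm{ord}(h)$ is even, and $\gamma_h = 1 - \frac{1}{\mathrm{ord}(h)}$ if $\mathrm{ord}(h)$ is odd. Write $[m]=\{1,\ldots,m\}$. $2$-matching: a $2$-matching over $[m]$ is a family $M$ of pairwise disjoint subsets of $[m]$, each of cardinality exactly $2$. Its size $|M|$ is the number of sets in $M$. Special linear $(2,\delta)$-LDC (Locally Decodable Code): for integers $t,m\ge 1$ and $\delta\in[0,1]$, a sequence $A=(a_1,\ldots,a_m)\in(\mathbb{F}^t)^m$ of $m$ vectors in $\mathbb{F}^t$ is a special linear $(2,\delta)$-LDC if for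 all $i\in[t]$ there exists a $2$-matching $M_i$ over $[m]$ such that (1) for every $S=\{j_1,j_2\}\in M_i$ there is a scalar $\lambda\in\mathbb{F}$ such that $\mathbf{e}_i=\lambda(a_{j_1}-a_{j_2})$, where $\mathbf{e}_i$ is the $i$-th standard basis vector of $\mathbb{F}^t$; and (2) $\sum_{i=1}^t |M_i|\ge \delta m t$. *)

(* Defs.v *)
From HB Require Import structures.
From mathcomp Require Import all_boot all_order all_algebra.
From mathcomp Require Import all_fingroup all_solvable all_field all_character.
From mathcomp Require Import finmap boolp classical_sets cardinality reals.

Set Implicit Arguments.
Unset Strict Implicit.
Unset Printing Implicit Defensive.

Import Order.TTheory GRing.Theory Num.Theory.

Local Open Scope ring_scope.

Section Constants.
Context (K : realType).

Definition theta (F : fieldType) : K :=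
  if `[< finite_set [set: F]%classic >]
  then 1 - (#|` fset_set [set: F]%classic |%fset)%:R^-1
  else 1.

Definition gamma (gT : finGroupType) (h : gT) : K :=
  if odd #[h]%g then 1 - (#[h]%g)%:R^-1 else 1.

End Constants.

Definition two_matching (m : nat) (M : {set {set 'I_m}}) : bool :=
  finset.trivIset M && [forall S in M, #|S| == 2%N].

(* In the second clause [two_matching] forces j1 != j2. *)
Definition special_linear_LDC2 (K : realType) (F : fieldType) (m t : nat)
    (delta : K) (a : m.-tuple 'rV[F]_t) : Prop :=
  [/\ (0 < t)%N, (0 < m)%N, 0 <= delta <= 1 &
   exists M : 'I_t -> {set {set 'I_m}},
   [/\ forall i, two_matching (M i),
       forall i (j1 j2 : 'I_m), [set j1; j2]%SET \in M i ->
         exists lambda : F,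
           delta_mx 0 i = lambda *: (tnth a j1 - tnth a j2) &
       delta * m%:R * t%:R <= (\sum_(i < t) #|M i|)%N%:R]].

(* Main.v *)
Require Import Defs.
From HB Require Import structures.
From mathcomp Require Import all_boot all_order all_algebra.
From mathcomp Require Import all_fingroup all_solvable all_field all_character.
From mathcomp Require Import finmap boolp classical_sets cardinality reals.
From mathcomp Require Import ring.

(** A conjugate h^s acts as rho (h^s) = 1 + N_s, where N_s is conjugate to
    rho h - 1, so it has rank at most r. The row spaces of the N_s together are
    stable under G, hence they span F^n by irreducibility
    ([irreducible_conjugates_span]). In a minimal spanning subfamily, which has
    at least n/r members, no row space lies in the sum of the others. Linear
    algebra then gives t = ceil(n/r) conjugates g_i and columns v_1, ..., v_t
    such that (rho g_i - 1) v_k vanishes exactly when k <> i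
    ([exists_dual_family]).

    Let V be the matrix with columns v_k. For a row vector w, the code word
    indexed by x is a_x = w rho(x) V. Then
    a_(x g_i) - a_x = w rho(x) (rho g_i - 1) V is a multiple of e_i, and the
    factor is nonzero as soon as w is not orthogonal to the nonzero vector
    rho(x) (rho g_i - 1) v_i. Each left coset of the cyclic group <g_i>, which
    has d = ord(h) elements, contains d/2 (rounded down) disjoint pairs
    {x, x g_i}; this rounding is the origin of the factor gamma_h / 2.

    The row w is chosen by averaging: for entries drawn independently and
    uniformly from a finite set of q scalars, a fixed nonzero vector is
    orthogonal to w with probability at most 1/q. With q = |F|, some w keeps at
    least a proportion 1 - 1/|F| of all the pairs; over an infinite field q can
    exceed the number of pairs, and then some w keeps all of them
    ([exists_row_avoiding]). This is the factor theta_F. *)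

Set Implicit Arguments.
Unset Strict Implicit.
Unset Printing Implicit Defensive.

Import Order.TTheory GRing.Theory Num.Theory.

Local Open Scope ring_scope.

(** * Row vectors orthogonal to few members of a finite family *)

Definition sample_row (F : fieldType) (s : seq F) (n q : nat)
    (w : {ffun 'I_n -> 'I_q}) : 'rV[F]_n := \row_k s`_(w k).

(** Where u has a nonzero coordinate j, the entry of an orthogonal row at j is
    determined by its other entries. So overwriting that entry with an arbitrary
    sample loses no information, and it maps pairs (sample, orthogonal row)
    injectively into all rows. *)
Lemma card_sample_orthogonal (F : fieldType) (s : seq F) (n : nat)
    (u : 'cV[F]_n) :
    uniq s -> u != 0 ->
  (size s * #|[set w : {ffun 'I_n -> 'I_(size s)}
                | sample_row s w *m u == 0%R]%SET| <= size s ^ n)%N.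
Proof.
move=> s_uniq /cV0Pn[j uj_neq0]; set bad := finset _.
pose subst (p : 'I_(size s) * {ffun 'I_n -> 'I_(size s)}) :=
  [ffun k => if k == j then p.1 else p.2 k].
have subst_inj : {in finset.setX [set: 'I_(size s)]%SET bad &, injective subst}.
  move=> [a w] [b w']; rewrite !inE /= => w_bad w'_bad /ffunP eq_aw.
  have eq_ab : a = b by have := eq_aw j; rewrite !ffunE eqxx.
  have eq_off k : k != j -> w k = w' k.
    by move=> kj; have := eq_aw k; rewrite !ffunE (negPf kj).
  have eq_at : w j = w' j.
    move/eqP: w_bad; move/eqP: w'_bad => <- /matrixP/(_ 0 0).
    rewrite !mxE (bigD1 j) // [in RHS](bigD1 j) //= !mxE.
    under eq_bigr => k kj do rewrite mxE (eq_off _ kj).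
    under [in RHS]eq_bigr => k kj do rewrite mxE.
    move=> /addIr/(mulIf uj_neq0)/eqP.
    by rewrite nth_uniq // => /eqP/val_inj.
  congr (_, _) => //; apply/ffunP => k.
  by case: (eqVneq k j) => [->|/eq_off].
have := max_card (mem (subst @: finset.setX [set: 'I_(size s)]%SET bad)%SET).
by rewrite card_ffun !card_ord (card_in_imset subst_inj) cardsX cardsT card_ord.
Qed.

(** First-moment argument: summing the previous bound over P and exchanging the
    sums, the average over all sampled rows of the number of orthogonal members
    is at most #|P| / size s. *)
Lemma exists_row_few_orthogonal (F : fieldType) (s : seq F) (n : nat)
    (I : finType) (P : {set I}) (u : I -> 'cV[F]_n) :
    uniq s -> (0 < size s)%N -> {in P, forall p, u p != 0} ->
  exists w : 'rV[F]_n,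
    (size s * #|[set p in P | w *m u p == 0%R]%SET| <= #|P|)%N.
Proof.
move=> s_uniq s_gt0 u_neq0; apply: contrapT => /forallNP few.
pose W := {ffun 'I_n -> 'I_(size s)}.
have cardW : #|{: W}| = (size s ^ n)%N by rewrite card_ffun !card_ord.
have lower : (#|{: W}| * #|P|.+1 <= \sum_(w : W)
    size s * #|[set p in P | sample_row s w *m u p == 0%R]%SET|)%N.
  rewrite -sum_nat_const; apply: leq_sum => w _.
  by rewrite ltnNge; apply/negP/few.
have upper : (\sum_(w : W)
    size s * #|[set p in P | sample_row s w *m u p == 0%R]%SET|
      <= #|P| * #|{: W}|)%N.
  under eq_bigr => w _ do rewrite -sum1dep_card big_mkcondr big_distrr /=.
  rewrite exchange_big -sum_nat_const; apply: leq_sum => p pP /=.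
  rewrite -big_distrr -big_mkcond sum1dep_card cardW.
  exact: card_sample_orthogonal (u_neq0 p pP).
have := leq_trans lower upper.
by rewrite mulnC leq_mul2r ltnn orbF cardW expn_eq0 eqn0Ngt s_gt0.
Qed.

(** For finite F the sample is the whole field. For infinite F it is any finite
    set with more than #|P| elements, so that the number of orthogonal members,
    being less than 1, is zero. *)
Lemma exists_row_avoiding (K : realType) (F : fieldType) (n : nat)
    (I : finType) (P : {set I}) (u : I -> 'cV[F]_n) :
    {in P, forall p, u p != 0} ->
  exists w : 'rV[F]_n,
    theta K F * #|P|%:R <= #|[set p in P | w *m u p != 0%R]%SET|%:R.
Proof.
move=> u_neq0; rewrite /theta.
have split_card (w : 'rV[F]_n) : #|P| = (#|[set p in P | w *m u p == 0%R]%SET|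
    + #|[set p in P | w *m u p != 0%R]%SET|)%N.
  rewrite -(cardsID [set p | w *m u p == 0%R]%SET P); congr (_ + _)%N.
    by apply: eq_card => p; rewrite !inE.
  by apply: eq_card => p; rewrite !inE andbC.
case: asboolP => [F_fin|/infinite_set_fsetP/(_ #|P|.+1)[B _ B_big]].
  set B := fset_set _.
  have B_gt0 : (0 < size B)%N.
    by rewrite cardfs_gt0; apply/fset0Pn; exists 0; rewrite in_fset_set // inE.
  have [w] := exists_row_few_orthogonal (fset_uniq B) B_gt0 u_neq0.
  rewrite -(ler_nat K) natrM => few; exists w.
  rewrite mulrBl mul1r lerBlDr {1}(split_card w) natrD addrC lerD2l.
  by rewrite ler_pdivlMl ?ltr0n.
have [w few] := exists_row_few_orthogonal (fset_uniq B)
  (leq_trans (ltn0Sn _) B_big) u_neq0.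
exists w; rewrite mul1r (split_card w) ler_nat.
have -> : #|[set p in P | w *m u p == 0%R]%SET| = 0%N; last by [].
apply/eqP; rewrite -leqn0 leqNgt; apply/negP => bad_gt0.
have := leq_trans B_big (leq_trans (leq_pmulr _ bad_gt0) few).
by rewrite ltnn.
Qed.

(** * Conjugates with a dual family of columns *)

Lemma rank_sums_le (F : fieldType) (I : finType) (n r : nat) (S : {set I})
    (N : I -> 'M[F]_n) :
    {in S, forall s, (\rank (N s) <= r)%N} ->
  (\rank (\sum_(s in S) N s)%MS <= #|S| * r)%N.
Proof.
move=> rank_N; apply: leq_trans (mxrank_sum_leqif _).1 _.
by rewrite /= -sum_nat_const; apply: leq_sum => s /rank_N.
Qed.

(** In an inclusion-minimal spanning subfamily S, the row space of N s is not
    contained in the sum W of the others. Some column of the cokernel matrix of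
    W is therefore not killed by N s, while all the other members kill it. The
    hypothesis on t expresses t <= ceil(n/r) without a division; since n is at
    most #|S| * r, it yields t <= #|S|. *)
Lemma exists_dual_family (F : fieldType) (I : finType) (n r t : nat)
    (D : {set I}) (N : I -> 'M[F]_n) :
    (1%:M <= \sum_(s in D) N s)%MS ->
    {in D, forall s, (\rank (N s) <= r)%N} ->
    (forall k, n <= k * r -> t <= k)%N ->
  exists (f : 'I_t -> I) (V : 'M[F]_(n, t)) (u : 'I_t -> 'cV[F]_n),
    forall i, [/\ f i \in D, u i != 0 &
      N (f i) *m V = u i *m delta_mx 0 i].
Proof.
move=> D_full rank_N t_min.
pose spans (S : {set I}) := (1%:M <= \sum_(s in S) N s)%MS.
have [S /minsetP[S_full S_min] S_sub_D] := @minset_exists I spans D D_full.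
have t_le_S : (t <= #|S|)%N.
  apply: t_min; rewrite -[n in (n <= _)%N](mxrank1 F).
  apply: leq_trans (mxrankS S_full) (rank_sums_le _) => s.
  by move/(fintype.subsetP S_sub_D)/rank_N.
pose f (i : 'I_t) : I := enum_val (widen_ord t_le_S i).
have f_in i : f i \in S by apply: enum_valP.
have f_inj : injective f.
  by move=> i k /enum_val_inj /(congr1 val) /= /val_inj.
pose W i : 'M[F]_n := (\sum_(s in S :\ f i) N s)%MS.
have N_notin i : ~~ (N (f i) <= W i)%MS.
  apply/negP => NW; suff /S_min/(_ (subD1set _ _)) eqS : spans (S :\ f i)%SET.
    by have := f_in i; rewrite -eqS !inE eqxx.
  apply: submx_trans S_full _; apply/sumsmx_subP => s sS.
  have [-> //|s_neq] := eqVneq s (f i).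
  by apply: (sumsmx_sup s); rewrite ?inE ?s_neq ?submx_refl.
have col_ex i : exists j, col j (N (f i) *m cokermx (W i)) != 0.
  apply: contrapT => /forallNP all0; have /negP[] := N_notin i.
  rewrite submxE; apply/eqP/matrixP => a b; rewrite [RHS]mxE.
  have /negP := all0 b; rewrite negbK => /eqP/matrixP/(_ a 0).
  by rewrite !mxE.
pose j i := xchoose (col_ex i).
exists f, (\matrix_(a, k) cokermx (W k) a (j k)),
  (fun i => col (j i) (N (f i) *m cokermx (W i))) => i; split.
- exact: (fintype.subsetP S_sub_D).
- exact: (xchooseP (col_ex i)).
apply/matrixP => a k; rewrite [RHS]mxE big_ord1 !mxE eqxx /= eq_sym.
under eq_bigr => b _ do rewrite mxE.
have [<-|k_neq] := eqVneq i k; first by rewrite mulr1.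
have /sub_kermxP : (N (f i) <= kermx (cokermx (W k)))%MS.
  apply/sub_kermxP/eqP; rewrite -submxE.
  by apply: (sumsmx_sup (f i));
    rewrite ?submx_refl // !inE f_in (inj_eq f_inj) k_neq.
by move/matrixP/(_ a (j k)); rewrite !mxE mulr0.
Qed.

(** Multiplying rho (h ^ s) - 1 by rho x on the right gives a left multiple of
    rho (h ^ (s * x)) - 1, so the sum is a submodule; it is nonzero because
    of its term s = 1. *)
Lemma irreducible_conjugates_span (F : fieldType) (gT : finGroupType)
    (G : {group gT}) (n : nat) (rho : mx_representation F G n) (h : gT) :
    mx_irreducible rho -> h \in G -> rho h - 1%:M != 0 ->
  (1%:M <= \sum_(s in G) (rho (h ^ s)%g - 1%:M))%MS.
Proof.
move=> [_ _ rho_min] hG h_neq0; set U := (\sum_(s in G) _)%MS.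
have conj_mul s x : s \in G -> x \in G ->
    (rho (h ^ s)%g - 1%:M) *m rho x
      = rho x *m (rho (h ^ (s * x))%g - 1%:M).
  move=> sG xG; rewrite mulmxBl mulmxBr mul1mx mulmx1.
  by rewrite -!repr_mxM ?groupJ ?groupM // conjgM conjgC.
apply: rho_min; rewrite ?submx1 //.
  apply/mxmoduleP => x xG; rewrite /U sumsmxMr.
  apply/sumsmx_subP => s sG; rewrite conj_mul //.
  apply: submx_trans (submxMl _ _) _.
  by apply: (sumsmx_sup (s * x)%g); rewrite ?groupM.
apply: contra_neq h_neq0 => U0; apply/eqP; rewrite -submx0 -U0.
by apply: (sumsmx_sup 1%g); rewrite ?conjg1.
Qed.

Lemma rank_conjugate_le (F : fieldType) (gT : finGroupType)
    (G : {group gT}) (n : nat) (rho : mx_representation F G n) (h s : gT) :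
    h \in G -> s \in G ->
  (\rank (rho (h ^ s)%g - 1%:M)%R <= \rank (rho h - 1%:M)%R)%N.
Proof.
move=> hG sG.
have -> : rho (h ^ s)%g - 1%:M = rho s^-1%g *m (rho h - 1%:M) *m rho s.
  rewrite mulmxBr mulmxBl mulmx1 -!repr_mxM ?groupM ?groupV //.
  by rewrite mulVg repr_mx1 conjgE mulgA.
exact: leq_trans (mxrankM_maxl _ _) (mxrankM_maxr _ _).
Qed.

(** * Pairs, and the cosets of a cyclic group *)

Lemma matching_of_pairs (m : nat) (I : finType) (P : {set I})
    (x y : I -> 'I_m) :
    {in P &, injective x} -> {in P &, injective y} ->
    {in P &, forall p q, x p != y q} ->
  let M := [set [set x p; y p]%SET | p in P]%SET in
  two_matching M /\ #|M| = #|P|.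
Proof.
move=> x_inj y_inj xy M.
have pair_meet p q : p \in P -> q \in P ->
    ~~ [disjoint [set x p; y p]%SET & [set x q; y q]%SET] -> p = q.
  move=> pP qP; rewrite -setI_eq0 => /finset.set0Pn[z].
  rewrite !inE => /andP[/orP[]/eqP-> /orP[]/eqP].
  - exact: x_inj.
  - by move/eqP; rewrite (negPf (xy p q pP qP)).
  - by move/esym/eqP; rewrite (negPf (xy q p qP pP)).
  - exact: y_inj.
split; last first.
  apply: card_in_imset => p q pP qP eq_pq; apply: pair_meet => //.
  rewrite eq_pq -setI_eq0 finset.setIid; apply/finset.set0Pn; exists (x q).
  by rewrite !inE eqxx.
apply/andP; split.
  apply/finset.trivIsetP => _ _ /imsetP[p pP ->] /imsetP[q qP ->] neq_pq.
  by apply: contraNT neq_pq => /(pair_meet _ _ pP qP) ->.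
apply/forallP => S; apply/implyP => /imsetP[p pP ->].
by rewrite cards2 xy.
Qed.

(** Representatives of the left cosets of <[h]> serve as T. Listing each coset
    from its representative x, as x, x h, ..., x h^(#[h] - 1), gives every
    element of G unique coordinates (x, a), in which the pairs {x, x h} of the
    matchings become {(x, 2k), (x, 2k + 1)}. *)
Lemma exists_cycle_transversal (gT : finGroupType) (G : {group gT}) (h : gT) :
    h \in G ->
  exists T : {set gT}, [/\ T \subset G, (#|T| * #[h]%g = #|G|)%N &
    forall x y a b, x \in T -> y \in T -> (a < #[h]%g)%N -> (b < #[h]%g)%N ->
      (x * h ^+ a = y * h ^+ b)%g -> x = y /\ a = b].
Proof.
move=> hG; pose H := <[h]>%G.
have H_sub_G : H \subset G by rewrite cycle_subG.
have repr_in A : A \in lcosets H G -> repr A \in A.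
  by case/lcosetsP=> x _ ->; apply: mem_repr (lcoset_refl H x).
have repr_coset A : A \in lcosets H G -> A = (repr A *: H)%g.
  move=> AG; have := repr_in A AG; case/lcosetsP: AG => x _ ->.
  by move/lcoset_eqP.
exists [set repr A | A in lcosets H G]%SET; split.
- apply/fintype.subsetP => _ /imsetP[A AG ->]; have := repr_in A AG.
  case/lcosetsP: AG => x xG -> /lcosetP[z zH ->].
  by rewrite groupM // (fintype.subsetP H_sub_G).
- rewrite card_in_imset => [|A B AG BG eqAB].
    by rewrite card_lcosets mulnC (Lagrange H_sub_G).
  by rewrite (repr_coset A AG) eqAB -repr_coset.
move=> _ _ a b /imsetP[A AG ->] /imsetP[B BG ->] a_lt b_lt eq_ab.
have eqAB : A = B.
  rewrite (repr_coset A AG) (repr_coset B BG); apply/lcoset_eqP.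
  apply/lcosetP; exists (h ^+ b * h ^- a)%g.
    by rewrite groupM 1?groupV ?groupX ?cycle_id.
  by rewrite mulgA -eq_ab mulgK.
split; first by rewrite eqAB.
move: eq_ab; rewrite eqAB => /mulgI/eqP.
by rewrite eq_expg_mod_order !modn_small // => /eqP.
Qed.

Lemma set2_eq_cases (T : finType) (a b x y : T) :
    x != y -> [set a; b]%SET = [set x; y]%SET ->
  (a = x /\ b = y) \/ (a = y /\ b = x).
Proof.
move=> neq eq_ab; have : x \in [set a; b]%SET by rewrite eq_ab set21.
have : y \in [set a; b]%SET by rewrite eq_ab set22.
rewrite !inE => /orP[]/eqP ya /orP[]/eqP xb; subst; rewrite ?eqxx // in neq *.
  by right.
by left.
Qed.

Lemma card_sum_fibres (I J : finType) (P : {set I * J}) :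
  #|P| = (\sum_(i : I) #|[set j | (i, j) \in P]%SET|)%N.
Proof.
under [RHS]eq_bigr => i _ do rewrite -sum1dep_card.
rewrite (pair_big_dep xpredT (fun i j => (i, j) \in P) (fun _ _ => 1%N)) /=.
by rewrite -sum1_card; apply: eq_bigl => -[].
Qed.

(** * The constants *)

(** Both sides count the elements that are paired in a cycle of length #[h]:
    all of them if the length is even, all but one if it is odd. *)
Lemma half_order_gamma (K : realType) (gT : finGroupType) (h : gT) :
  gamma K h * #[h]%g%:R = ((#[h]%g)./2).*2%:R.
Proof.
rewrite /gamma; have := odd_double_half #[h]%g; case: odd => /= half.
  rewrite mulrBl mul1r mulVf ?pnatr_eq0 -?lt0n ?order_gt0 //.
  by rewrite -[in LHS]half natrD addrC addKr.
by rewrite mul1r -[in LHS]half.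
Qed.

Lemma theta_gamma_half_bounds (K : realType) (F : fieldType)
    (gT : finGroupType) (h : gT) :
  0 <= theta K F * gamma K h / 2 <= 1.
Proof.
have unit_sub (k : nat) : 0 <= (1 - k%:R^-1 : K) <= 1.
  rewrite subr_ge0 gerBl invr_ge0 ler0n andbT.
  by case: k => [|k]; rewrite ?invr0 ?ler01 // invf_le1 ?ltr0n // ler1n.
have /andP[th0 th1] : 0 <= theta K F <= 1.
  by rewrite /theta; case: ifP; rewrite ?unit_sub // ler01 lexx.
have /andP[ga0 ga1] : 0 <= gamma K h <= 1.
  by rewrite /gamma; case: ifP; rewrite ?unit_sub // ler01 lexx.
rewrite !mulr_ge0 ?invr_ge0 //= ler_pdivrMr // mul1r.
by rewrite (le_trans (mulr_ile1 th0 ga0 th1 ga1)) // ler1n.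
Qed.

Lemma ceil_divn (K : realType) (n r : nat) :
    (0 < n)%N -> (0 < r)%N ->
  let t := (n.-1 %/ r).+1 in
  t%:Z = Num.ceil (n%:R / r%:R : K) /\ (forall k, n <= k * r -> t <= k)%N.
Proof.
move=> n_gt0 r_gt0 t; split.
  have t_pred : t%:Z - 1 = (n.-1 %/ r)%N by rewrite -[t]addn1 PoszD addrK.
  apply/esym/ceil_def; rewrite t_pred -!pmulrn.
  rewrite ltr_pdivlMr ?ltr0n // ler_pdivrMr ?ltr0n // -!natrM ltr_nat ler_nat.
  rewrite -[n in (_ < n)%N](prednK n_gt0) ltnS leq_divM /=.
  by rewrite -[n in (n <= _)%N](prednK n_gt0) ltn_ceil.
by move=> k n_le; rewrite /t ltn_divLR // prednK.
Qed.

(** * Assembling the code *)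

Theorem theorem1p6 (K : realType) (F : fieldType) (gT : finGroupType)
    (G : {group gT}) (n : nat) (n_ge1 : (1 <= n)%N)
    (rho : mx_representation F G n) (rho_irr : mx_irreducible rho)
    (r : nat) (r_ge1 : (1 <= r)%N) (h : gT) (hG : h \in G)
    (rank_h : (0 < \rank (rho h - 1%:M)%R <= r)%N) :
  exists (m t : nat) (A : m.-tuple 'rV[F]_t),
    [/\ m = #|G|,
        t%:Z = Num.ceil (n%:R / r%:R : K) &
        special_linear_LDC2 (theta K F * gamma K h / 2) A].
Proof.
have [t_ceil t_min] := ceil_divn K n_ge1 r_ge1.
move: (n.-1 %/ r).+1 (ltn0Sn (n.-1 %/ r)) t_ceil t_min => t t_gt0 t_ceil t_min.
case/andP: rank_h => rank_gt0 rank_le.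
have h_neq0 : rho h - 1%:M != 0 by rewrite -mxrank_eq0 -lt0n.
have [f [V [u dual]]] := exists_dual_family
  (irreducible_conjugates_span rho_irr hG h_neq0)
  (fun s sG => leq_trans (rank_conjugate_le rho hG sG) rank_le) t_min.
pose g i := (h ^ f i)%g.
have gG i : g i \in G by rewrite groupJ //; case: (dual i).
have g_order i : #[g i]%g = #[h]%g by rewrite orderJ.
have [T transv] := choice (fun i => exists_cycle_transversal (gG i)).
set d := #[h]%g in g_order *.
(* A pair (c, k) stands for the two consecutive elements c g_i^(2k) and
   c g_i^(2k+1), told apart by the boolean. *)
pose elt i (p : gT * 'I_d./2) (b : bool) :=
  (p.1 * g i ^+ (b + (p.2 : nat).*2))%g.
pose P := [set q : 'I_t * (gT * 'I_d./2) | q.2.1 \in T q.1]%SET.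
have elt_G i p b : (i, p) \in P -> elt i p b \in G.
  rewrite inE /= => pT; have [/fintype.subsetP TG _ _] := transv i.
  by rewrite groupM ?groupX ?gG // TG.
have elt_inj i p p' b b' : (i, p) \in P -> (i, p') \in P ->
    elt i p b = elt i p' b' -> p = p' /\ b = b'.
  rewrite !inE /= => pT p'T; have [_ _ inj] := transv i.
  have exp_lt (k : 'I_d./2) (c : bool) : (c + (k : nat).*2 < #[g i]%g)%N.
    have d_ge : ((d./2).*2 <= d)%N by rewrite -{2}(odd_double_half d) leq_addl.
    rewrite g_order; apply: leq_trans d_ge.
    have : ((k : nat).+1.*2 <= (d./2).*2)%N by rewrite leq_double ltn_ord.
    by apply: leq_trans; rewrite doubleS; case: (c).
  move=> /(inj _ _ _ _ pT p'T (exp_lt _ _) (exp_lt _ _)).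
  case: p p' {pT p'T} => [c k] [c' k'] /= [-> eq_k].
  have := congr1 odd eq_k; rewrite !oddD !odd_double !addbF !oddb => eq_b.
  by move: eq_k; rewrite eq_b => /addnI/double_inj/val_inj ->.
(* The two code words of the pair p differ by the multiple w *m v (i, p) of the
   i-th basis vector, so the pair is usable when this scalar is nonzero. *)
pose v (q : 'I_t * (gT * 'I_d./2)) := rho (elt q.1 q.2 false) *m u q.1.
have v_neq0 : {in P, forall q, v q != 0}.
  move=> [i p] qP; have [_ ui_neq0 _] := dual i; apply: contra_neq ui_neq0.
  by rewrite /v /= => /(congr1 (mulmx (rho (elt i p false)^-1%g)));
    rewrite mulmxA -repr_mxM ?groupV ?elt_G // mulVg repr_mx1 mul1mx mulmx0.
have [w w_good] := exists_row_avoiding K v_neq0.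
set good := finset _ in w_good.
pose good_at i := [set p | (i, p) \in good]%SET.
have good_P i p : p \in good_at i -> (i, p) \in P by rewrite !inE => /andP[].
pose pos (x : gT) : 'I_#|G| := enum_rank_in (group1 G) x.
have posK : {in G, cancel pos enum_val} by move=> x xG; apply: enum_rankK_in.
pose M i := [set [set pos (elt i p false); pos (elt i p true)]%SET
  | p in good_at i]%SET.
have pos_inj i p p' b b' : p \in good_at i -> p' \in good_at i ->
    pos (elt i p b) = pos (elt i p' b') -> p = p' /\ b = b'.
  move=> /good_P pP /good_P p'P; move/(can_in_inj posK) => eq_elt.
  by apply: elt_inj (eq_elt _ _); rewrite ?elt_G.
have M_matching i : two_matching (M i) /\ #|M i| = #|good_at i|.
  apply: matching_of_pairs => p p' pP p'P.
  - by case/(pos_inj i p p' _ _ pP p'P).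
  - by case/(pos_inj i p p' _ _ pP p'P).
  - by apply/eqP => /(pos_inj i p p' _ _ pP p'P)[].
exists #|G|, t, [tuple w *m rho (enum_val j) *m V | j < #|G|].
split=> //; split=> //; first exact: theta_gamma_half_bounds.
exists M; split=> [i|i j1 j2|].
- by case: (M_matching i).
- case/imsetP=> p p_good eq_j; pose c := (w *m v (i, p)) 0 0.
  have c_neq0 : c != 0.
    move: p_good; rewrite !inE => /andP[_]; apply: contra_neq => c0.
    by apply/matrixP => a b; rewrite !ord1 [LHS]c0 mxE.
  have diff : w *m rho (elt i p true) *m V - w *m rho (elt i p false) *m V
      = c *: delta_mx 0 i.
    have [_ _ dual_i] := dual i.
    have -> : rho (elt i p true) = rho (elt i p false) *m rho (g i).
      by rewrite -repr_mxM ?elt_G ?good_P // /elt -mulgA -expgSr.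
    rewrite -mulmxBl -mulmxBr -{2}[rho (elt i p false)]mulmx1 -mulmxBr.
    rewrite -!mulmxA dual_i !mulmxA [w *m _ *m u i]mx11_scalar.
    by rewrite mul_scalar_mx -mulmxA.
  have tnth_pos b : tnth [tuple w *m rho (enum_val j) *m V | j < #|G|]
      (pos (elt i p b)) = w *m rho (elt i p b) *m V.
    by rewrite tnth_mktuple posK ?elt_G ?good_P.
  have neq : pos (elt i p true) != pos (elt i p false).
    by apply/eqP => /(pos_inj i p p _ _ p_good p_good)[].
  have [[-> ->]|[-> ->]] := set2_eq_cases neq (etrans eq_j (finset.setUC _ _)).
  + exists c^-1; rewrite !tnth_pos diff scalerA mulVf // scale1r //.
  + exists (- c^-1); rewrite !tnth_pos -opprB diff scalerN scaleNr opprK.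
    by rewrite scalerA mulVf // scale1r.
have cardP : (#|P| * d = t * #|G| * d./2)%N.
  rewrite card_sum_fibres big_distrl /=.
  rewrite (eq_bigr (fun _ => #|G| * d./2)%N) ?sum_nat_const ?card_ord ?mulnA //.
  move=> i _; have [_ <- _] := transv i; rewrite g_order.
  have -> : [set p | (i, p) \in P]%SET = finset.setX (T i) [set: 'I_d./2]%SET.
    by apply/finset.setP => p; rewrite !inE andbT.
  by rewrite cardsX cardsT card_ord mulnAC.
have d_neq0 : d%:R != 0 :> K by rewrite pnatr_eq0 -lt0n order_gt0.
have -> : (\sum_(i < t) #|M i| = #|good|)%N.
  rewrite [RHS]card_sum_fibres; apply: eq_bigr => i _.
  by case: (M_matching i).
apply: le_trans w_good; rewrite le_eqVlt; apply/orP; left; apply/eqP.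
(* What is left is an equality, as #|P| = t * (#|G| / d) * d./2. *)
rewrite -!mulrA; congr (_ * _); apply: (mulIf d_neq0).
rewrite -[RHS]natrM cardP !natrM.
have := half_order_gamma K h; rewrite -/d -muln2 natrM => gamma_d.
have two_neq0 : 2%:R != 0 :> K by rewrite pnatr_eq0.
apply: (mulIf two_neq0); rewrite -[RHS]mulrA -gamma_d.
by field.
Qed.
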